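(* Let $F:\mathbb{R}^n\to\mathbb{R}$ be continuous, bounded below, and differentiable with locally Lipschitz continuous gradient $\dot F$. Let $C\subset\mathbb{R}^n$ be compact, and let $$\mathcal{G}=\sup\Big\{\|\dot F(\theta)\|_2:\ \theta\in C\cup\{\psi:\inf_{\phi\in C}\|\psi-\phi\|_2\le10\}\Big\}.$$ Let the algorithm described in the context be applied to $F$ from an arbitrary $\theta_0\in\mathbb{R}^n$, with parameters $\rho,\overline\delta,\delta_0$, and let $\{\ell_t:t+1\in\mathbb{N}\}$ be the indices of accepted iterates defined in the context. Suppose $C$ is an isolated, local PL region of $F$ of size $10+\overline\alpha\,\overline\delta\,\mathcal{G}$, where $\overline\alpha=10^{-16}+10^{16}$, with PL constant $\mu>0$. Suppose there exists $\tau\in\mathbb{N}\cup\{0\}$ with $\ell_\tau<\infty$ such that $\theta_{\ell_\tau}\in C$. Then either the algorithm terminates in finite time at a stationary point in $C$, or there exists $\underline\delta>0$ with $\delta_k\ge\underline\delta$ for all $k\in\{0,1,2,\ldots\}$ such that, for all $t\ge\tau$, $\theta_{\ell_t}\in C$ and $$F(\theta_{\ell_t})-\underline F\le(1-\rho\,\underline\delta\,\underline\alpha\,\mu)^{t-\tau}\big(F(\theta_{\ell_\tau})-\underline F\big),$$ where $\underline F=\inf_{\theta\in C}F(\theta)$ and $\underline\alpha=10^{-16}$.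
   Context: Isolated, local Polyak–Łojasiewicz (PL) region. Let $F:\mathbb{R}^n\to\mathbb{R}$ be differentiable, $C\subset\mathbb{R}^n$ compact and $R>0$. $C$ is an isolated, local PL region of $F$ of size $R$ if: (1) there exists $\mu>0$ (the PL constant) such that $\|\dot F(\theta)\|_2^2\ge\mu(F(\theta)-\underline F)$ for all $\theta\in C$, where $\underline F=\inf_{\psi\in C}F(\psi)$; and (2) for all $\theta\in\{\theta\in\mathbb{R}^n:\mathrm{dist}(\theta,C)\le R\}\setminus C$, $F(\theta)>\sup_{\psi\in C}F(\psi)$, where $\mathrm{dist}(\theta,C)=\inf_{\psi\in C}\|\theta-\psi\|_2$. Algorithm. $F:\mathbb{R}^n\to\mathbb{R}$ is differentiable with gradient $\dot F$. Inputs: $\theta_0\in\mathbb{R}^n$, $\rho\in(0,1)$, $\overline\delta\in(0,\infty)$, $\delta_0\in(0,\overline\delta]$. Set $\tau_{\mathrm{low}}^0=\|\dot F(\theta_0)\|_2/\sqrt2$ and $\tau_{\mathrm{upp}}^0=\sqrt{10}\,\|\dot F(\theta_0)\|_2$. For outer iterations $k=0,1,2,\ldots$: if $\dot F(\theta_k)=0$, terminate. Otherwise set $\psi_0^k=\theta_k$, $j=0$, and run the inner loop: (i) Compute $\hat L_j^k$: $\hat L_0^0=1$; $\hat L_0^k=\hat L_{j_{k-1}}^{k-1}$ for $k>0$; and for $j>0$, with $q=\|\dot F(\psi_j^k)-\dot F(\psi_{j-1}^k)\|_2/\|\psi_j^k-\psi_{j-1}^k\|_2$, set $\hat L_j^k=q$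 if $k=0$ or $\theta_k\ne\theta_{k-1}$, and $\hat L_j^k=\max(q,\hat L_{j-1}^k)$ if $k>0$ and $\theta_k=\theta_{k-1}$. (ii) With $g=\|\dot F(\psi_j^k)\|_2$, set $C_{j,1}^k=g^3+\tfrac12 g^2\hat L_j^k+10^{-16}$, $C_{j,2}^k=g+\tfrac12\hat L_j^k+10^{-16}$, and $\alpha_j^k=\min\big((\tau_{\mathrm{low}}^k)^2/C_{j,1}^k,\ 1/C_{j,2}^k\big)+10^{-16}$. (iii) Check whether a triggering event occurs: $\|\psi_j^k-\theta_k\|_2>10$, or $\|\dot F(\psi_j^k)\|_2\notin(\tau_{\mathrm{low}}^k,\tau_{\mathrm{upp}}^k)$, or $j=100$. If none occurs, set $\psi_{j+1}^k=\psi_j^k-\delta_k\alpha_j^k\dot F(\psi_j^k)$, replace $j$ by $j+1$, and return to (i). If one occurs, set $j_k=j$ (one has $0<j_k\le100$), exit the inner loop, and update as follows: - (reject) if $F(\psi_{j_k}^k)\ge F(\theta_k)-\rho\delta_k\alpha_0^k\|\dot F(\theta_k)\|_2^2$: $\theta_{k+1}=\theta_k$, $\delta_{k+1}=\tfrac12\delta_k$, thresholds unchanged; - (accept) else if $\|\dot F(\psi_{j_k}^k)\|_2\le\tau_{\mathrm{low}}^k$: $\theta_{k+1}=\psi_{j_k}^k$, $\delta_{k+1}=\delta_k$, $\tau_{\mathrm{low}}^{k+1}=\|\dot F(\theta_{k+1})\|_2/\sqrt2$, $\tau_{\mathrm{upp}}^{k+1}=\sqrt{20}\,\tau_{\mathrm{low}}^{k+1}$;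 - (accept) else if $\|\dot F(\psi_{j_k}^k)\|_2\ge\tau_{\mathrm{upp}}^k$: $\theta_{k+1}=\psi_{j_k}^k$, $\delta_{k+1}=\min\{1.5\,\delta_k,\overline\delta\}$, $\tau_{\mathrm{low}}^{k+1}=\|\dot F(\theta_{k+1})\|_2/\sqrt2$, $\tau_{\mathrm{upp}}^{k+1}=\sqrt{20}\,\tau_{\mathrm{low}}^{k+1}$; - (accept) else: $\theta_{k+1}=\psi_{j_k}^k$, $\delta_{k+1}=\min\{1.5\,\delta_k,\overline\delta\}$, thresholds unchanged. If the algorithm terminates at outer iteration $K$, put $\theta_k=\theta_K$ and $\delta_k=\delta_K$ for $k\ge K$. Accepted iterates: $\ell_0=0$ and $\ell_t=\min\{k>\ell_{t-1}:\theta_k\ne\theta_{\ell_{t-1}}\}$ for $t\in\mathbb{N}$, with $\ell_t=\infty$ if no such finite $k$ exists or if $\ell_{t-1}=\infty$. (In the non-terminating alternative the claim includes that the $\ell_t$ appearing are finite.) A function is locally Lipschitz continuous if every point has an open ball around it on which the function is Lipschitz continuous. *)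

(* Defs.v *)
From HB Require Import structures.
From mathcomp Require Import all_boot all_order all_algebra.
From mathcomp Require Import all_classical all_reals all_analysis.

Set Implicit Arguments.
Unset Strict Implicit.
Unset Printing Implicit Defensive.

Import Order.TTheory GRing.Theory Num.Theory.
Import numFieldNormedType.Exports.
Local Open Scope classical_set_scope.
Local Open Scope ring_scope.

(* R^n is ['rV[R]_n]. The library norm on it is the sup norm, which is only used here
   through the topology and [differentiable]; all quantitative notions below
   use the Euclidean norm. *)
Definition l2norm (R : realType) (n : nat) (x : 'rV[R]_n) : R :=
  Num.sqrt (\sum_i x 0 i ^+ 2).

(* The gradient whenever F is differentiable at x. *)
Definition grad (R : realType) (n : nat) (F : 'rV[R]_n -> R) (x : 'rV[R]_n) :
    'rV[R]_n :=
  \row_i 'D_(delta_mx 0 i) F x.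

(* [sup]/[inf] on R are meaningful only for nonempty bounded sets, so this is
   the distance only when C is nonempty. *)
Definition dist (R : realType) (n : nat) (x : 'rV[R]_n) (C : set 'rV[R]_n) : R :=
  inf [set l2norm (x - y) | y in C].

Definition locally_lipschitz (R : realType) (m n : nat)
    (f : 'rV[R]_m -> 'rV[R]_n) : Prop :=
  forall x, exists2 r : R, 0 < r & exists L : R, forall y z,
    l2norm (y - x) < r -> l2norm (z - x) < r ->
    l2norm (f y - f z) <= L * l2norm (y - z).

Definition PL_constant (R : realType) (n : nat) (F : 'rV[R]_n -> R)
    (C : set 'rV[R]_n) (mu : R) : Prop :=
  0 < mu /\
  forall x, C x -> mu * (F x - inf (F @` C)) <= l2norm (grad F x) ^+ 2.

Definition isolated_local_PL_region (R : realType) (n : nat)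
    (F : 'rV[R]_n -> R) (C : set 'rV[R]_n) (r : R) : Prop :=
  [/\ forall x, differentiable F x,
      compact C,
      0 < r,
      exists mu, PL_constant F C mu
    & forall x, dist x C <= r -> ~ C x -> sup (F @` C) < F x].

Definition alpha_low (R : realType) : R := 10 ^- 16.
Definition alpha_upp (R : realType) : R := 10 ^- 16 + 10 ^+ 16.

(* The data available at the start of outer iteration k: theta_k, theta_(k-1)
   ([None] if k = 0), delta_k, the two thresholds, and the estimate
   \hat L_0^k (that is, 1 if k = 0, otherwise the last estimate of the previous
   inner loop). *)
Record outer_state (R : realType) (n : nat) := OuterState {
  st_theta : 'rV[R]_n;
  st_prev : option 'rV[R]_n;
  st_delta : R;
  st_low : R;
  st_upp : R;
  st_L0 : R
}.

(* alpha_j^k as a function of tau_low^k, \hat L_j^k and g = |grad F psi_j^k|. *)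
Definition step_size (R : realType) (low L g : R) : R :=
  let C1 := g ^+ 3 + 2^-1 * g ^+ 2 * L + 10 ^- 16 in
  let C2 := g + 2^-1 * L + 10 ^- 16 in
  Num.min (low ^+ 2 / C1) (1 / C2) + 10 ^- 16.

(* The pair (psi_j^k, \hat L_j^k), generated without testing for triggering
   events; the entries after the first triggering event are never used. *)
Fixpoint inner (R : realType) (n : nat) (F : 'rV[R]_n -> R)
    (s : outer_state R n) (j : nat) : 'rV[R]_n * R :=
  if j is i.+1 then
    let: (psi, L) := inner F s i in
    let alpha := step_size (st_low s) L (l2norm (grad F psi)) in
    let psi' := psi - (st_delta s * alpha) *: grad F psi in
    let q := l2norm (grad F psi' - grad F psi) / l2norm (psi' - psi) in
    (psi', if st_prev s == Some (st_theta s) then Num.max q L else q)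
  else (st_theta s, st_L0 s).

Definition trigger (R : realType) (n : nat) (F : 'rV[R]_n -> R)
    (s : outer_state R n) (j : nat) : bool :=
  let psi := (inner F s j).1 in
  [|| 10 < l2norm (psi - st_theta s),
      ~~ (st_low s < l2norm (grad F psi) < st_upp s)
    | j == 100%N].

(* j_k, the least j with [trigger F s j]; it is at most 100. *)
Definition trigger_index (R : realType) (n : nat) (F : 'rV[R]_n -> R)
    (s : outer_state R n) : nat :=
  find (trigger F s) (iota 0 101).

(* After termination (zero gradient) the state is kept unchanged. *)
Definition outer_step (R : realType) (n : nat) (F : 'rV[R]_n -> R)
    (rho dbar : R) (s : outer_state R n) : outer_state R n :=
  let: OuterState th _ d low upp L0 := s in
  if grad F th == 0 then s else
  let: (psi, L) := inner F s (trigger_index F s) in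
  let g := l2norm (grad F psi) in
  let g0 := l2norm (grad F th) in
  let low' := g / Num.sqrt 2 in
  let upp' := Num.sqrt 20 * low' in
  let dup := Num.min (3 / 2 * d) dbar in
  if F th - rho * d * step_size low L0 g0 * g0 ^+ 2 <= F psi then
    OuterState th (Some th) (2^-1 * d) low upp L
  else if g <= low then
    OuterState psi (Some th) d low' upp' L
  else if upp <= g then
    OuterState psi (Some th) dup low' upp' L
  else
    OuterState psi (Some th) dup low upp L.

Definition initial_state (R : realType) (n : nat) (F : 'rV[R]_n -> R)
    (theta0 : 'rV[R]_n) (delta0 : R) : outer_state R n :=
  let g := l2norm (grad F theta0) in
  OuterState theta0 None delta0 (g / Num.sqrt 2) (Num.sqrt 10 * g) 1.

Definition run (R : realType) (n : nat) (F : 'rV[R]_n -> R)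
    (theta0 : 'rV[R]_n) (rho dbar delta0 : R) (k : nat) : outer_state R n :=
  iter k (outer_step F rho dbar) (initial_state F theta0 delta0).

Definition terminates_at (R : realType) (n : nat) (F : 'rV[R]_n -> R)
    (theta : nat -> 'rV[R]_n) (K : nat) : Prop :=
  grad F (theta K) = 0 /\ forall k, (k < K)%N -> grad F (theta k) <> 0.

Definition next_accepted (T : eqType) (theta : nat -> T) (l : nat) : option nat :=
  match pselect (exists k, (l < k)%N && (theta k != theta l)) with
  | left h => Some (ex_minn h)
  | right _ => None
  end.

(* ell_t, with [None] standing for ell_t = +oo. *)
Fixpoint accepted (T : eqType) (theta : nat -> T) (t : nat) : option nat :=
  if t is t'.+1 then obind (next_accepted theta) (accepted theta t')
  else Some 0%N.

(* Main.v *)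
(* On the 10-neighbourhood of C, which lies in a compact ball, the locally
   Lipschitz gradient is bounded by G and a gradient step of length at most some
   uniform e > 0 decreases F by at least (1 + rho)/2 times the first order
   prediction. Every inner iterate before the last is within 10 of theta_k, so
   the last one is within 10 + alpha_upp dbar G of C; being accepted it lies
   strictly below sup_C F, hence isolation puts it back in C. While theta_k is
   in C, delta_k <= e / alpha_upp forces acceptance, so delta_k stays bounded
   below; as each rejection halves delta_k, rejections cannot go on forever.
   Each acceptance then decreases F by rho dlow alpha_low |grad F theta_k|^2,
   which the PL inequality turns into a contraction of F - Flow. *)
Require Import Defs.
From HB Require Import structures.
From mathcomp Require Import all_boot all_order all_algebra.
From mathcomp Require Import all_classical all_reals all_analysis.
From mathcomp Require Import ring lra.

Set Implicit Arguments.
Unset Strict Implicit.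
Unset Printing Implicit Defensive.

Import Order.TTheory GRing.Theory Num.Theory.
Import numFieldNormedType.Exports.
Local Open Scope classical_set_scope.
Local Open Scope ring_scope.

(** * Euclidean geometry of row vectors and comparison with the sup norm *)

Section EuclideanNorm.
Variables (R : realType) (n : nat).
Implicit Types (x y z : 'rV[R]_n) (a : R).

Definition dotr x y : R := \sum_i x 0 i * y 0 i.

Lemma dotrDl x y z : dotr (x + y) z = dotr x z + dotr y z.
Proof. by rewrite -big_split; apply: eq_bigr => i _; rewrite mxE mulrDl. Qed.

Lemma dotrZl a x y : dotr (a *: x) y = a * dotr x y.
Proof. by rewrite mulr_sumr; apply: eq_bigr => i _; rewrite mxE mulrA. Qed.

Lemma dotrC x y : dotr x y = dotr y x.
Proof. by apply: eq_bigr => i _; rewrite mulrC. Qed.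

Lemma dotrBl x y z : dotr (x - y) z = dotr x z - dotr y z.
Proof. by rewrite -scaleN1r dotrDl dotrZl mulN1r. Qed.

Lemma dotr_ge0 x : 0 <= dotr x x.
Proof. by apply: sumr_ge0 => i _; rewrite -expr2 sqr_ge0. Qed.

Lemma l2normE x : l2norm x = Num.sqrt (dotr x x).
Proof. by congr Num.sqrt; apply: eq_bigr => i _; rewrite expr2. Qed.

Lemma sqr_l2norm x : l2norm x ^+ 2 = dotr x x.
Proof. by rewrite l2normE sqr_sqrtr // dotr_ge0. Qed.

Lemma l2norm_ge0 x : 0 <= l2norm x.
Proof. exact: sqrtr_ge0. Qed.

Lemma l2norm_eq0 x : l2norm x = 0 -> x = 0.
Proof.
move=> x0; have /eqP := sqr_l2norm x; rewrite x0 expr0n /= eq_sym.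
rewrite psumr_eq0 => [/allP x0i|i _]; last by rewrite -expr2 sqr_ge0.
apply/rowP => i; rewrite mxE; apply/eqP.
by have := x0i i (mem_index_enum i); rewrite /= mulf_eq0 orbb.
Qed.

Lemma l2norm_gt0 x : x != 0 -> 0 < l2norm x.
Proof.
move=> x0; rewrite lt_def l2norm_ge0 andbT.
by apply: contra_neq x0 => /l2norm_eq0.
Qed.

Lemma l2norm0 : l2norm (0 : 'rV[R]_n) = 0.
Proof. by rewrite l2normE /dotr big1 ?sqrtr0// => i _; rewrite mxE mul0r. Qed.

Lemma l2normZ a x : l2norm (a *: x) = `|a| * l2norm x.
Proof.
by rewrite !l2normE dotrZl dotrC dotrZl mulrA -expr2 sqrtrM ?sqr_ge0// sqrtr_sqr.
Qed.

Lemma l2normN x : l2norm (- x) = l2norm x.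
Proof. by rewrite -scaleN1r l2normZ normrN1 mul1r. Qed.

(** Cauchy-Schwarz: the vector $|x|^2 y - \langle x,y\rangle x$ has squared norm $|x|^2(|x|^2|y|^2 -
    \langle x,y\rangle^2)$, which is nonnegative. *)
Lemma dotr_le x y : dotr x y <= l2norm x * l2norm y.
Proof.
have [->|x0] := eqVneq x 0.
  by rewrite l2norm0 mul0r /dotr big1// => i _; rewrite mxE mul0r.
have := dotr_ge0 (l2norm x ^+ 2 *: y - dotr x y *: x).
have xp := l2norm_gt0 x0.
rewrite dotrBl !dotrZl ![dotr _ (_ - _)]dotrC !dotrBl !dotrZl -!sqr_l2norm.
rewrite [dotr y x]dotrC.
set d := dotr x y; set X := l2norm x; set Y := l2norm y => h.
have : 0 <= X ^+ 2 * ((X * Y) ^+ 2 - d ^+ 2) by move: h; lra.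
rewrite pmulr_rge0 ?exprn_gt0// subr_ge0 -(real_normK (num_real d)).
rewrite ler_pXn2r ?nnegrE//.
  by apply: le_trans; exact: ler_norm.
by rewrite mulr_ge0 ?l2norm_ge0.
Qed.

Lemma ler_l2normD x y : l2norm (x + y) <= l2norm x + l2norm y.
Proof.
rewrite -(@ler_pXn2r _ 2) ?nnegrE ?addr_ge0 ?l2norm_ge0// sqr_l2norm.
rewrite dotrDl ![dotr _ (_ + _)]dotrC !dotrDl -!sqr_l2norm [dotr y x]dotrC.
by have := dotr_le x y; lra.
Qed.

Lemma ler_l2distD z x y : l2norm (x - y) <= l2norm (x - z) + l2norm (z - y).
Proof. by rewrite -[x - y](subrKA z) ler_l2normD. Qed.

Lemma ler_coord_norm x i : `|x 0 i| <= `|x|.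
Proof.
rewrite [`|x|]mx_normrE.
exact: (le_bigmax 0 (fun ij => `|x ij.1 ij.2|) (0, i)).
Qed.

Lemma norm_le_l2norm x : `|x| <= l2norm x.
Proof.
rewrite [`|x|]mx_normrE; apply/bigmax_leP; split=> [|[j i] _ /=].
  exact: l2norm_ge0.
rewrite ord1 -sqrtr_sqr ler_wsqrtr// (bigD1 i)//= lerDl.
by apply: sumr_ge0 => k _; exact: sqr_ge0.
Qed.

Lemma l2norm_le_norm x : l2norm x <= Num.sqrt n%:R * `|x|.
Proof.
rewrite -[`|x|]normr_id -sqrtr_sqr -sqrtrM// ler_wsqrtr//.
rewrite mulr_natl -[X in _ *+ X]card_ord -sumr_const; apply: ler_sum => i _.
by rewrite -real_normK ?num_real// lerXn2r ?nnegrE// ler_coord_norm.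
Qed.

Lemma near_l2norm x e : 0 < e -> \forall y \near x, l2norm (y - x) < e.
Proof.
(* The [+ 1] keeps the denominator positive when [n] is 0. *)
move=> e0; apply/nbhs_ballP; exists (e / (Num.sqrt n%:R + 1)) => /=.
  by rewrite divr_gt0// ltr_wpDl// sqrtr_ge0.
move=> y; rewrite -ball_normE /= distrC => xy.
have s0 : 0 <= Num.sqrt n%:R :> R by exact: sqrtr_ge0.
apply: le_lt_trans (l2norm_le_norm _) _.
apply: (@le_lt_trans _ _ ((Num.sqrt n%:R + 1) * `|y - x|)).
  by rewrite ler_wpM2r// lerDl.
by rewrite mulrC -ltr_pdivlMr// ltr_wpDl.
Qed.

Lemma closed_ball0_compact a : compact [set x : 'rV[R]_n | `|x| <= a].
Proof.
apply: bounded_closed_compact.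
  exists a; split; first exact: num_real.
  by move=> M aM x /= xa; rewrite (le_trans xa)// ltW.
apply: (@preimage_closed _ _ (fun x : 'rV[R]_n => `|x|) [set r | r <= a]).
  by move=> x _; exact: norm_continuous.
exact: closed_le.
Qed.

Lemma dist_le x y (C : set 'rV[R]_n) : C y -> dist x C <= l2norm (x - y).
Proof.
move=> Cy; apply: inf_lbound; last by exists y.
by exists 0 => _ [z _ <-]; exact: l2norm_ge0.
Qed.

(** Nonemptiness excludes the default value 0 of [inf] on the empty set. *)
Lemma dist_lt_ex x (C : set 'rV[R]_n) a :
  C !=set0 -> dist x C < a -> exists2 y, C y & l2norm (x - y) < a.
Proof.
move=> [y Cy] xa.
have [|_ [z Cz <-] za] := inf_lt _ xa; last by exists z.
by exists (l2norm (x - y)), y.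
Qed.

End EuclideanNorm.

(** * Sufficient decrease along gradient steps *)

Section GradientDescent.
Variables (R : realType) (n : nat) (F : 'rV[R]_n -> R).
Implicit Types (x y g : 'rV[R]_n).
Hypothesis dF : forall x, differentiable F x.

Lemma derive_grad x g : 'D_g F x = dotr (grad F x) g.
Proof.
rewrite deriveE// {1}[g]row_sum_delta linear_sum; apply: eq_bigr => i _.
by rewrite linearZ /= -deriveE// mxE mulrC.
Qed.

Lemma is_derive_line x g (t : R) :
  is_derive t 1 (fun s => F (x + s *: g)) ('D_g F (x + t *: g)).
Proof.
(* The difference quotients of the restriction to the line, at [t], are those of [F] at [x + t *: g]
   in direction [g]. *)
have e : (fun h : R => h^-1 *:
    (((fun s => F (x + s *: g)) \o shift t) (h *: (1 : R)) - F (x + t *: g))) =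
  (fun h : R => h^-1 *: ((F \o shift (x + t *: g)) (h *: g) - F (x + t *: g))).
  apply/funext => h; rewrite /= [h *: 1]mulr1 scalerDl.
  by rewrite addrCA.
apply: DeriveDef; last by rewrite /derive e.
by rewrite /derivable e; exact: diff_derivable.
Qed.

Lemma MVT_line x g (s : R) : 0 < s -> exists2 c, 0 < c < s &
  F (x + s *: g) - F x = s * dotr (grad F (x + c *: g)) g.
Proof.
move=> s0.
have cont : {within `[0, s], continuous (fun t => F (x + t *: g))}.
  apply: derivable_within_continuous => t _.
  by have [] := is_derive_line x g t.
have [c cs] := MVT s0 (fun t _ => is_derive_line x g t) cont.
rewrite scale0r addr0 subr0 derive_grad mulrC => e.
by exists c; first by rewrite in_itv in cs.
Qed.

Hypothesis lipF : locally_lipschitz (grad F).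

Lemma grad_bounded_near x : exists2 M : R, 0 <= M &
  \forall y \near x, l2norm (grad F y) <= M.
Proof.
have [r r0 [L lipL]] := lipF x.
(* The Lipschitz constant [L] may be negative, hence its absolute value. *)
have M0 : 0 <= l2norm (grad F x) + `|L| * r.
  by rewrite addr_ge0 ?l2norm_ge0 ?mulr_ge0// ltW.
exists (l2norm (grad F x) + `|L| * r) => //.
near=> y; rewrite -[grad F y](subrK (grad F x)) addrC.
apply: le_trans (ler_l2normD _ _) _; rewrite lerD2l.
have yx : l2norm (y - x) < r by near: y; exact: near_l2norm.
apply: le_trans (lipL _ _ yx _) _; first by rewrite subrr l2norm0.
apply: le_trans (ler_norm _) _.
by rewrite normrM ler_wpM2l// ger0_norm ?l2norm_ge0// ltW.
Unshelve. all: by end_near. Qed.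

Lemma grad_bounded (K : set 'rV[R]_n) : compact K ->
  exists M : R, forall x, K x -> l2norm (grad F x) <= M.
Proof.
move=> /compact_near_coveringP cK.
(* Near-covering compactness along the filter at $+\infty$: a bound valid near a point stays valid
   for every larger number, so one eventual bound serves all of [K]. *)
have := cK R (pinfty_nbhs R) (fun M x => l2norm (grad F x) <= M) _.
case=> [x _|M [_ MK]].
  have [M M0 yM] := grad_bounded_near x.
  exists ([set y | l2norm (grad F y) <= M], [set N | M <= N]) => /=.
    by split=> //; apply: nbhs_pinfty_ge; exact: num_real.
  by move=> [y N] [/= yM' MN]; exact: le_trans yM' MN.
by exists (M + 1) => x Kx; apply: MK => //; rewrite ltrDl.
Qed.

(** The Armijo sufficient decrease condition with parameter [r]. *)
Definition descent_step (r s : R) x : Prop :=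
  F (x - s *: grad F x) <= F x - r * s * l2norm (grad F x) ^+ 2.

(* The mean value theorem and a local Lipschitz bound [L] give
   F (x - s g) <= F x - s (1 - L s) |g|^2, so [r < 1] leaves room for all
   small [s], uniformly near each point. *)
Lemma descent_step_near (r : R) x : r < 1 ->
  \forall y \near x & e \near 0^'+, forall s, 0 < s -> s <= e ->
    descent_step r s y.
Proof.
move=> r1.
have [d d0 [L0 lipL0]] := lipF x.
have [M M0 yM] := grad_bounded_near x.
pose L := `|L0|.
have lipL y z : l2norm (y - x) < d -> l2norm (z - x) < d ->
    l2norm (grad F y - grad F z) <= L * l2norm (y - z).
  move=> yd zd; apply: le_trans (lipL0 _ _ yd zd) _.
  by rewrite ler_wpM2r ?l2norm_ge0 ?ler_norm.
have L_ge0 : 0 <= L by exact: normr_ge0.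
have d2 : 0 < d / 2 by rewrite divr_gt0.
have M1 : 0 < M + 1 by rewrite ltr_wpDl.
have L1 : 0 < L + 1 by rewrite ltr_wpDl.
(* The first bound on [e] keeps the segment from [y] to [y - s *: grad F y] inside the Lipschitz
   ball; the second gives [L * s <= 1 - r]. Adding 1 to [M] and [L] avoids division by zero. *)
exists ([set y | l2norm (y - x) < d / 2 /\ l2norm (grad F y) <= M],
    [set e | e * (M + 1) <= d / 2 /\ e * (L + 1) <= 1 - r]).
  split=> /=; first by apply: filterI => //; exact: near_l2norm.
  by near=> e; split; rewrite -ler_pdivlMr//; near: e;
    apply: nbhs_right_le; rewrite divr_gt0 ?subr_gt0.
move=> [y e] [/= [yx gM] [eM eL]] s s0 se; rewrite /descent_step.
set g := grad F y; set G := l2norm g.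
have G0 : 0 <= G by exact: l2norm_ge0.
have [c /andP[c0 cs]] := MVT_line y (- g) s0.
rewrite scalerN => /(canRL (subrK _)) ->.
have zy : l2norm (y + c *: - g - y) = c * G.
  by rewrite addrAC subrr add0r l2normZ l2normN gtr0_norm.
have cG : c * G <= d / 2.
  apply: le_trans eM; rewrite ler_pM ?(ltW c0)//.
    exact: le_trans (ltW cs) se.
  by apply: le_trans gM _; rewrite lerDl.
(* The slope at the intermediate point is $-|g|^2$ plus an error, controlled by Cauchy-Schwarz and
   the Lipschitz estimate at distance [c * G], with [c < s]. *)
have gl : dotr (grad F (y + c *: - g)) (- g) <= - G ^+ 2 + L * s * G ^+ 2.
  rewrite -[grad F _](subrK g) dotrDl addrC lerD//.
    by rewrite dotrC -scaleN1r dotrZl mulN1r -sqr_l2norm.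
  apply: le_trans (dotr_le _ _) _; rewrite l2normN -/G.
  apply: (@le_trans _ _ (L * (c * G) * G)).
    rewrite ler_wpM2r// -zy; apply: lipL.
      apply: le_lt_trans (ler_l2distD y _ _) _.
      by rewrite zy; move: cG yx; lra.
    by apply: lt_trans yx _; rewrite ltr_pdivrMr// ltr_pMr// ltr1n.
  by rewrite expr2 !mulrA !ler_wpM2r// ler_wpM2l// ltW.
have sL : L * s <= 1 - r.
  apply: le_trans eL; rewrite mulrC ler_pM// ?(ltW s0)//.
  by rewrite lerDl.
have G2 : 0 <= G ^+ 2 by exact: sqr_ge0.
have := ler_wpM2l (ltW s0) gl.
have := ler_wpM2l (ltW s0) (ler_wpM2r G2 sL).
lra.
Unshelve. all: by end_near. Qed.

(** The local thresholds on the step length merge by near-covering compactness, now along the filter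
    of positive numbers tending to 0. *)
Lemma descent_step_compact (r : R) (K : set 'rV[R]_n) : r < 1 -> compact K ->
  exists2 e : R, 0 < e & forall x s, K x -> 0 < s -> s <= e ->
    descent_step r s x.
Proof.
move=> r1 /compact_near_coveringP cK.
have H := cK R (0 : R)^'+ _ _ (fun x _ => descent_step_near x r1).
have [e [/= e0 eH]] := filter_ex (filterI (nbhs_right_gt (0 : R)) (H _)).
by exists e => // x s Kx; exact: eH.
Qed.

End GradientDescent.

(** * Uniform bounds on the step factor *)

Section StepSize.
Variables (R : realType).
Implicit Types (low L g : R).

Lemma alpha_low_gt0 : 0 < alpha_low R.
Proof. by rewrite invr_gt0 exprn_gt0. Qed.

Lemma alpha_upp_gt0 : 0 < alpha_upp R.
Proof. by rewrite addr_gt0 ?alpha_low_gt0 ?exprn_gt0. Qed.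

(** Both quotients in the minimum are nonnegative, so the added [10 ^- 16] is a floor. *)
Lemma step_size_ge low L g : 0 <= L -> 0 <= g -> alpha_low R <= step_size low L g.
Proof.
move=> L0 g0; rewrite /step_size /alpha_low lerDr le_min.
by rewrite !divr_ge0 ?sqr_ge0 ?addr_ge0 ?mulr_ge0 ?exprn_ge0 ?invr_ge0 ?exprn_ge0.
Qed.

(** The denominator [C2] is at least [10 ^- 16], which caps the minimum at [10 ^+ 16]. *)
Lemma step_size_le low L g : 0 <= L -> 0 <= g -> step_size low L g <= alpha_upp R.
Proof.
move=> L0 g0; rewrite /step_size /alpha_upp addrC lerD2l ge_min.
apply/orP; right; have t0 : 0 < 10 ^- 16 :> R by exact: alpha_low_gt0.
have C2 : 10 ^- 16 <= g + 2^-1 * L + 10 ^- 16.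
  by rewrite lerDr addr_ge0 ?mulr_ge0 ?invr_ge0.
rewrite div1r -[leRHS]invrK lef_pV2 ?posrE//.
exact: lt_le_trans t0 C2.
Qed.

End StepSize.

(** * Invariants of the inner and outer loops *)

Section Algorithm.
Variables (R : realType) (n : nat) (F : 'rV[R]_n -> R).
Implicit Types (s : outer_state R n) (j : nat).

Definition inner_step s j : R :=
  step_size (st_low s) (inner F s j).2 (l2norm (grad F (inner F s j).1)).

Lemma inner_psiS s j : (inner F s j.+1).1 =
  (inner F s j).1 - (st_delta s * inner_step s j) *: grad F (inner F s j).1.
Proof. by rewrite /inner_step /=; case: (inner F s j). Qed.

Lemma inner_L_ge0 s j : 0 <= st_L0 s -> 0 <= (inner F s j).2.
Proof.
move=> L0; elim: j => [|j IHj] //=; case: (inner F s j) IHj => psi L /= IHj.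
have q0 (x y z w : 'rV[R]_n) : 0 <= l2norm (x - y) / l2norm (z - w).
  by rewrite divr_ge0 ?l2norm_ge0.
by case: ifP => _ //; rewrite le_max q0.
Qed.

Lemma inner_step_ge s j : 0 <= st_L0 s -> alpha_low R <= inner_step s j.
Proof. by move=> L0; rewrite step_size_ge ?inner_L_ge0 ?l2norm_ge0. Qed.

Lemma inner_step_le s j : 0 <= st_L0 s -> inner_step s j <= alpha_upp R.
Proof. by move=> L0; rewrite step_size_le ?inner_L_ge0 ?l2norm_ge0. Qed.

Lemma inner_step_gt0 s j : 0 <= st_L0 s -> 0 < inner_step s j.
Proof. by move=> L0; rewrite (lt_le_trans (alpha_low_gt0 R)) ?inner_step_ge. Qed.

Lemma trigger_before s j : (j < trigger_index F s)%N -> ~~ trigger F s j.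
Proof.
move=> jt; have := before_find 0%N jt; rewrite nth_iota ?add0n => [->//|].
by apply: leq_trans jt _; rewrite -[leqRHS](size_iota 0) find_size.
Qed.

Lemma inner_near_theta s j : (j < trigger_index F s)%N ->
  l2norm ((inner F s j).1 - st_theta s) <= 10.
Proof. by move=> /trigger_before; rewrite !negb_or -leNgt => /and3P[]. Qed.

(** Invariant of the outer loop. The threshold clause is conditional because thresholds reset at a
    stationary point are both 0. *)
Definition wf_state (dbar : R) s : Prop :=
  [/\ 0 < st_delta s <= dbar, 0 <= st_L0 s &
      grad F (st_theta s) != 0 ->
      0 < st_low s /\ st_low s < l2norm (grad F (st_theta s)) < st_upp s].

(** At [j = 0] the displacement is 0 and the gradient norm lies strictly between the thresholds, so
    nothing triggers. *)
Lemma trigger_index_gt0 dbar s : wf_state dbar s -> grad F (st_theta s) != 0 ->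
  (0 < trigger_index F s)%N.
Proof.
move=> [_ _ H] /H [_ lu].
have -> : trigger_index F s =
  if trigger F s 0 then 0%N else (find (trigger F s) (iota 1 100)).+1 by [].
by rewrite /trigger subrr l2norm0 lu ltNge ler0n.
Qed.

Definition last_inner s := (inner F s (trigger_index F s)).1.

Definition accepts (rho : R) s : bool :=
  F (last_inner s) < F (st_theta s) -
    rho * st_delta s * inner_step s 0 * l2norm (grad F (st_theta s)) ^+ 2.

Lemma outer_step_stationary rho dbar s :
  grad F (st_theta s) = 0 -> outer_step F rho dbar s = s.
Proof. by case: s => th p d low upp L0 /= /eqP ->. Qed.

Lemma outer_step_reject rho dbar s : grad F (st_theta s) != 0 ->
  ~~ accepts rho s -> outer_step F rho dbar s =
  OuterState (st_theta s) (Some (st_theta s)) (2^-1 * st_delta s)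
    (st_low s) (st_upp s) (inner F s (trigger_index F s)).2.
Proof.
case: s => th p d low upp L0; rewrite /accepts /last_inner -leNgt /inner_step /=.
by move=> /negPf ->; case: (inner _ _ _) => psi L /= ->.
Qed.

Lemma outer_step_accept rho dbar s : grad F (st_theta s) != 0 ->
  accepts rho s -> outer_step F rho dbar s =
  let psi := last_inner s in
  let L := (inner F s (trigger_index F s)).2 in
  let g := l2norm (grad F psi) in
  let low := g / Num.sqrt 2 in
  let dup := Num.min (3 / 2 * st_delta s) dbar in
  if g <= st_low s then
    OuterState psi (Some (st_theta s)) (st_delta s) low (Num.sqrt 20 * low) L
  else if st_upp s <= g then
    OuterState psi (Some (st_theta s)) dup low (Num.sqrt 20 * low) L
  else OuterState psi (Some (st_theta s)) dup (st_low s) (st_upp s) L.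
Proof.
case: s => th p d low upp L0; rewrite /accepts /last_inner ltNge /inner_step /=.
by move=> /negPf ->; case: (inner _ _ _) => psi L /= /negPf ->.
Qed.

Lemma accept_theta rho dbar s : grad F (st_theta s) != 0 -> accepts rho s ->
  st_theta (outer_step F rho dbar s) = last_inner s.
Proof. by move=> g0 /outer_step_accept ->//=; do 2![case: ifP => // _]. Qed.

Lemma accept_delta rho dbar s : wf_state dbar s ->
  grad F (st_theta s) != 0 -> accepts rho s ->
  st_delta s <= st_delta (outer_step F rho dbar s) <= dbar.
Proof.
move=> [/andP[d0 dd] _ _] g0 /outer_step_accept -> //=.
have dup : st_delta s <= Num.min (3 / 2 * st_delta s) dbar <= dbar.
  by rewrite ge_min lexx orbT le_min dd !andbT; lra.
case: ifP => _ /=; first by rewrite lexx.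
by case: ifP.
Qed.

(** A reset puts the current gradient norm strictly between the new thresholds, because $1 < \sqrt 2
    < \sqrt c$. *)
Lemma reset_thresholds (g c : R) : 0 < g -> 2 < c ->
  0 < g / Num.sqrt 2 /\ g / Num.sqrt 2 < g < Num.sqrt c * (g / Num.sqrt 2).
Proof.
move=> g0 c2; have s20 : 0 < Num.sqrt 2 :> R by rewrite sqrtr_gt0.
have s21 : 1 < Num.sqrt 2 :> R by rewrite -[ltLHS]sqrtr1 ltr_sqrt ?ltr1n.
split; first by rewrite divr_gt0.
rewrite ltr_pdivrMr// ltr_pMr// s21 mulrCA ltr_pMr//.
by rewrite ltr_pdivlMr// mul1r ltr_sqrt// (lt_trans _ c2).
Qed.

Lemma wf_initial theta0 delta0 dbar : 0 < delta0 <= dbar ->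
  wf_state dbar (initial_state F theta0 delta0).
Proof.
move=> d0; split => //= /l2norm_gt0; set g := l2norm _ => g0.
have [] := reset_thresholds g0 (_ : 2 < 20); first by rewrite ltr_nat.
move=> low0 /andP[-> gu]; split => //=; apply: lt_le_trans gu _.
(* Since $\sqrt{20}\,g/\sqrt 2 = \sqrt{10}\,g$, the initial thresholds are those of a reset. *)
have -> : 20 = 10 * 2 :> R by rewrite -natrM.
have s2 : Num.sqrt 2 != 0 :> R by rewrite sqrtr_eq0 -ltNge.
by rewrite sqrtrM ?ler0n// -mulrA [_ * (g / _)]mulrC divfK.
Qed.

(** An accepting branch keeps the thresholds only when the new gradient norm already lies strictly
    between them; otherwise it resets them. *)
Lemma wf_outer_step rho dbar s : wf_state dbar s ->
  wf_state dbar (outer_step F rho dbar s).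
Proof.
move=> wf; have [/andP[d0 dd] L0 th] := wf.
have [g0|g0] := eqVneq (grad F (st_theta s)) 0.
  by rewrite outer_step_stationary.
have [acc|rej] := boolP (accepts rho s); last first.
  rewrite outer_step_reject//; split => //=; last exact: inner_L_ge0.
  by apply/andP; split; lra.
have /andP[dge dle] := accept_delta wf g0 acc.
split; first by rewrite dle (lt_le_trans d0 dge).
  rewrite outer_step_accept//=.
  by case: ifP => _ /=; last case: ifP => _ /=; exact: inner_L_ge0.
have c20 : 2 < 20 :> R by rewrite ltr_nat.
rewrite outer_step_accept//=; case: ifP => /= [_ /l2norm_gt0 h|/negbT].
  exact: reset_thresholds.
rewrite -ltNge => gl; case: ifP => /= [_ /l2norm_gt0 h|/negbT].
  exact: reset_thresholds.
by rewrite -ltNge => gu _; have [] := th g0; rewrite gl gu.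
Qed.

Lemma outer_step_half_delta rho dbar s : wf_state dbar s ->
  2^-1 * st_delta s <= st_delta (outer_step F rho dbar s).
Proof.
move=> wf; have [/andP[d0 _] _ _] := wf.
have [g0|g0] := eqVneq (grad F (st_theta s)) 0.
  by rewrite outer_step_stationary//; lra.
have [acc|rej] := boolP (accepts rho s); last by rewrite outer_step_reject.
by have /andP[+ _] := accept_delta wf g0 acc; lra.
Qed.

Lemma accept_decrease rho dbar s : 0 < rho -> wf_state dbar s ->
  grad F (st_theta s) != 0 -> accepts rho s -> F (last_inner s) < F (st_theta s).
Proof.
move=> rho0 [/andP[d0 _] L0 _] g0 acc; apply: lt_le_trans acc _.
by rewrite gerBl !mulr_ge0 ?l2norm_ge0 // ltW// inner_step_gt0.
Qed.

(** Every inner step is short enough for the Armijo condition. The first alone gains the fraction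
    [r] of the prediction and the later ones do not increase [F]; the gap between [rho] and [r]
    makes the acceptance test strict. *)
Lemma small_delta_accepts rho r e dbar s :
  wf_state dbar s -> grad F (st_theta s) != 0 -> rho < r -> 0 <= r ->
  (forall x a, l2norm (x - st_theta s) <= 10 -> 0 < a -> a <= e ->
     descent_step F r a x) ->
  st_delta s * alpha_upp R <= e -> accepts rho s.
Proof.
move=> wf g0 rhor r0 desc de; have [/andP[d0 _] L0 _] := wf.
have a0 j := inner_step_gt0 j L0.
have dec j : (j < trigger_index F s)%N -> F (inner F s j.+1).1 <=
    F (inner F s j).1 - r * (st_delta s * inner_step s j) *
                        l2norm (grad F (inner F s j).1) ^+ 2.
  move=> jt; rewrite inner_psiS; apply: desc; first exact: inner_near_theta.
    exact: mulr_gt0.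
  by apply: le_trans de; rewrite ler_pM2l// inner_step_le.
have first_step j : (0 < j <= trigger_index F s)%N -> F (inner F s j).1 <=
    F (st_theta s) - r * (st_delta s * inner_step s 0) *
                     l2norm (grad F (st_theta s)) ^+ 2.
  elim: j => [//|[_ t1|j IHj jt]]; first exact: (dec 0%N t1).
  apply: le_trans (IHj (ltnW jt)); apply: le_trans (dec _ jt) _.
  by rewrite gerBl !mulr_ge0 ?l2norm_ge0 ?(ltW d0) ?(ltW (a0 _)).
have t0 := trigger_index_gt0 wf g0.
rewrite /accepts /last_inner; apply: le_lt_trans (first_step _ _) _.
  by rewrite t0 leqnn.
by rewrite ltrD2l ltrN2 -!mulrA ltr_pM2r// !mulr_gt0 ?exprn_gt0 ?l2norm_gt0.
Qed.

Lemma last_inner_dist dbar G (C : set 'rV[R]_n) s :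
  wf_state dbar s -> grad F (st_theta s) != 0 -> C (st_theta s) ->
  (forall x, dist x C <= 10 -> l2norm (grad F x) <= G) ->
  dist (last_inner s) C <= 10 + alpha_upp R * dbar * G.
Proof.
move=> wf g0 Cs gG; have [/andP[d0 dd] L0 _] := wf.
have := trigger_index_gt0 wf g0; rewrite /last_inner.
(* The trigger index is positive, so a penultimate iterate [j] exists and has not triggered. *)
case: (trigger_index F s) (@inner_near_theta s) => // j near _.
apply: le_trans (dist_le _ Cs) _; rewrite inner_psiS addrAC.
have nearj := near j (ltnSn j).
apply: le_trans (ler_l2normD _ _) _; apply: lerD => //.
have a0 := inner_step_gt0 j L0.
rewrite l2normN l2normZ gtr0_norm ?mulr_gt0//.
apply: ler_pM; rewrite ?l2norm_ge0 ?mulr_ge0 ?(ltW d0) ?(ltW a0)//.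
  by rewrite mulrC ler_pM ?inner_step_le ?(ltW d0) ?(ltW a0).
by apply: gG; apply: le_trans (dist_le _ Cs) _.
Qed.

End Algorithm.

(** * Indices of accepted iterates *)

Section AcceptedIndices.
Variables (T : eqType) (theta : nat -> T).

(** The least index beyond [l] with a different iterate is a successor [k.+1], and by minimality
    step [k] still starts from [theta l]. This exhibits the outer step that made the change. *)
Lemma next_acceptedP l : (exists2 k, (l < k)%N & theta k != theta l) ->
  exists k, [/\ next_accepted theta l = Some k.+1, (l <= k)%N,
    theta k = theta l & theta k.+1 != theta l].
Proof.
move=> [m lm thm]; rewrite /next_accepted; case: pselect => [h|[]]; last first.
  by exists m; rewrite lm.
case: ex_minnP => -[//|k] /andP[lk thk] kmin; exists k; split => //.
apply/eqP; apply: contraT => thkl; have [lk'|] := ltnP l k.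
  by have := kmin k; rewrite lk' thkl ltnn => /(_ isT).
rewrite leq_eqVlt => /orP[/eqP kl|]; first by rewrite kl eqxx in thkl.
by rewrite ltnNge -ltnS lk.
Qed.

End AcceptedIndices.

(** * Neighbourhoods of compact sets, halving, and invariance of the region *)

Lemma dist_bounded (R : realType) (n : nat) (C : set 'rV[R]_n) (a : R) :
  compact C -> C !=set0 -> exists b : R, forall x, dist x C <= a -> `|x| <= b.
Proof.
(* Boundedness holds for each number strictly above [B], and the infimum in [dist] need not be
   attained: each costs a [+ 1]. *)
move=> /compact_bounded[B [_ CB]] C0; exists (B + 1 + (a + 1)) => x xa.
have [|y Cy xy] := @dist_lt_ex _ _ x C (a + 1) C0; first by move: xa; lra.
have -> : x = y + (x - y) by rewrite addrC subrK.
rewrite (le_trans (ler_normD _ _))// lerD//.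
  by apply: CB => //; rewrite ltrDl.
exact: le_trans (norm_le_l2norm _) (ltW xy).
Qed.

Lemma continuous_compact_has_ubound (R : realType) (T : topologicalType)
  (F : T -> R) (C : set T) : continuous F -> compact C -> has_ubound (F @` C).
Proof.
move=> Fc /(continuous_compact (continuous_subspaceT Fc)) /compact_bounded.
move=> [M [_ MF]]; exists (M + 1) => y Fy.
by apply: le_trans (ler_norm _) (MF _ _ _ Fy); rewrite ltrDl.
Qed.

Lemma halving_lt (R : realType) (a b : R) : 0 < b ->
  exists m, 2^-1 ^+ m * a < b.
Proof.
move=> b0; exists (Num.truncn (a / b)).+1.
rewrite exprVn mulrC ltr_pdivrMr ?exprn_gt0// mulrC -ltr_pdivrMr//.
rewrite (lt_le_trans (truncnS_gt _))// -natrX ler_nat.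
exact: ltnW (ltn_expl _ _).
Qed.

Lemma last_inner_in_region (R : realType) (n : nat) (F : 'rV[R]_n -> R)
    (C : set 'rV[R]_n) (rho dbar G : R) (s : outer_state R n) :
  continuous F -> compact C -> 0 < rho -> wf_state F dbar s ->
  (forall x, dist x C <= 10 -> l2norm (grad F x) <= G) ->
  (forall x, dist x C <= 10 + alpha_upp R * dbar * G -> ~ C x ->
    sup (F @` C) < F x) ->
  grad F (st_theta s) != 0 -> C (st_theta s) -> accepts F rho s ->
  C (last_inner F s).
Proof.
move=> Fc cC rho0 wf gG iso g0 Cs acc; apply: contrapT => nC.
have := iso _ (last_inner_dist wf g0 Cs gG) nC; apply/negP; rewrite -leNgt.
apply: le_trans (ltW (accept_decrease rho0 wf g0 acc)) _.
by apply: ub_le_sup; [exact: continuous_compact_has_ubound|exists (st_theta s)].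
Qed.

(** * Convergence of the accepted iterates *)

Theorem theorem4 (R : realType) (n : nat) (F : 'rV[R]_n -> R)
    (C : set 'rV[R]_n) (theta0 : 'rV[R]_n) (rho dbar delta0 mu : R)
    (tau ltau : nat) :
  let G := sup [set l2norm (grad F x) |
                x in C `|` [set psi | dist psi C <= 10]] in
  let theta k := st_theta (run F theta0 rho dbar delta0 k) in
  let delta k := st_delta (run F theta0 rho dbar delta0 k) in
  let ell := accepted theta in
  let Flow := inf (F @` C) in
  continuous F ->
  has_lbound (range F) ->
  (forall x, differentiable F x) ->
  locally_lipschitz (grad F) ->
  compact C ->
  0 < rho < 1 ->
  0 < dbar ->
  0 < delta0 <= dbar ->
  isolated_local_PL_region F C (10 + alpha_upp R * dbar * G) ->
  PL_constant F C mu ->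
  ell tau = Some ltau ->
  C (theta ltau) ->
  (exists2 K, terminates_at F theta K & C (theta K)) \/
  (exists2 dlow, 0 < dlow &
    (forall k, dlow <= delta k) /\
    (forall t, (tau <= t)%N ->
      exists2 l, ell t = Some l &
        C (theta l) /\
        F (theta l) - Flow <=
          (1 - rho * dlow * alpha_low R * mu) ^+ (t - tau)
            * (F (theta ltau) - Flow))).
Proof.
move=> G theta delta ell Flow Fc [Flb lbF] dF lipF cC /andP[rho0 rho1] dbar0 d0.
move=> [_ _ _ _ iso] [mu0 PL] elltau Ctau.
pose st := run F theta0 rho dbar delta0.
have stS k : st k.+1 = outer_step F rho dbar (st k) by [].
have wf k : wf_state F dbar (st k).
  by elim: k => [|k IHk]; [exact: wf_initial|rewrite stS; exact: wf_outer_step].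
have [B distB] : exists B : R, forall x, dist x C <= 10 -> `|x| <= B.
  by apply: dist_bounded => //; exists (theta ltau).
have cB := @closed_ball0_compact R n B.
(* The set defining [G] lies in the ball of radius [B], so its values are bounded and [sup] is a
   true upper bound. *)
have gG x : dist x C <= 10 -> l2norm (grad F x) <= G.
  move=> x10; apply: ub_le_sup; last by exists x => //; right.
  have [M gM] := grad_bounded lipF cB; exists M => _ [y y10 <-].
  apply/gM/distB; case: y10 => // Cy; apply: le_trans (dist_le _ Cy) _.
  by rewrite subrr l2norm0.
have Cstay k : grad F (theta k) != 0 -> C (theta k) -> accepts F rho (st k) ->
    C (last_inner F (st k)).
  exact: (last_inner_in_region Fc cC rho0 (wf k) gG iso).
have Cth k : (ltau <= k)%N -> C (theta k).
  elim: k => [|k IHk]; first by rewrite leqn0 => /eqP <-.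
  rewrite leq_eqVlt => /predU1P[<- //|/IHk Ck].
  rewrite /theta -/st stS; have [g0|g0] := eqVneq (grad F (theta k)) 0.
    by rewrite outer_step_stationary.
  have [acc|rej] := boolP (accepts F rho (st k)).
    by rewrite accept_theta//; exact: Cstay.
  by rewrite outer_step_reject.
have [ex0|nstat] := pselect (exists k, grad F (theta k) == 0).
  left; case: (ex_minnP ex0) => K /eqP gK minK; exists K.
    by split=> // k kK /eqP /minK; rewrite leqNgt kK.
  (* If [K] precedes [ltau], the run is frozen from [K] on, so [theta K] is [theta ltau]. *)
  have [/Cth //|/ltnW /subnKC Kltau] := leqP ltau K.
  suff stK : st ltau = st K by rewrite /theta -/st -stK.
  rewrite -Kltau; elim: (_ - _)%N => [|m IHm]; first by rewrite addn0.
  by rewrite addnS stS IHm outer_step_stationary.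
have {nstat} g0 k : grad F (theta k) != 0.
  by apply/negP => gk; apply: nstat; exists k.
(* Strictly between [rho], for strict acceptance, and 1, for the descent estimate. *)
pose r := (1 + rho) / 2.
have [r1 rhor r0] : [/\ r < 1, rho < r & 0 <= r] by rewrite /r; split; lra.
have [e e0 desc] := descent_step_compact dF lipF r1 cB.
have small_accepts k : (ltau <= k)%N -> ~~ accepts F rho (st k) ->
    e / alpha_upp R < delta k.
  move=> lk; apply: contraR; rewrite -leNgt ler_pdivlMr ?alpha_upp_gt0// => de.
  apply: (small_delta_accepts (wf k) (g0 k) rhor r0) de => x a x10.
  by apply: desc; apply: distB; exact: le_trans (dist_le _ (Cth k lk)) x10.
(* Up to [ltau] each step at worst halves [delta]. Later a rejection requires [delta] above
   [e / alpha_upp R], so the halved value stays above half of that. *)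
pose d1 := Num.min (2^-1 ^+ ltau * delta0) (2^-1 * (e / alpha_upp R)).
have au0 := alpha_upp_gt0 R; have al0 := alpha_low_gt0 R.
have delta0_gt0 : 0 < delta0 by case/andP: d0.
have delta_half k : 2^-1 ^+ k * delta0 <= delta k.
  elim: k => [|k IHk]; first by rewrite expr0 mul1r.
  apply: le_trans (outer_step_half_delta rho (wf k)).
  by rewrite exprS -mulrA ler_pM2l.
have delta_ge k : d1 <= delta k.
  have [kl|] := leqP k ltau.
    apply: le_trans (delta_half k); rewrite ge_min ler_pM2r//.
    by rewrite ler_wiXn2l ?invr_ge0// invf_le1// ler1n.
  elim: k => // k IHk; rewrite ltnS => lk.
  have {}IHk : d1 <= delta k.
    move: lk; rewrite leq_eqVlt => /predU1P[<-|/IHk //].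
    by apply: le_trans (delta_half ltau); rewrite ge_min lexx.
  rewrite /delta -/st stS; have [acc|rej] := boolP (accepts F rho (st k)).
    by have /andP[+ _] := accept_delta (wf k) (g0 k) acc; exact: le_trans.
  rewrite (outer_step_reject _ (g0 k) rej) /=.
  apply: (@le_trans _ _ (2^-1 * (e / alpha_upp R))).
    by rewrite ge_min lexx orbT.
  by rewrite ler_pM2l// ltW// small_accepts.
have d1_gt0 : 0 < d1 by rewrite lt_min !mulr_gt0 ?exprn_gt0 ?invr_gt0.
have accept_after l : (ltau <= l)%N ->
    exists2 k, (l <= k)%N & accepts F rho (st k).
  move=> ll; apply: contrapT => nacc.
  have rej k : (l <= k)%N -> ~~ accepts F rho (st k).
    by move=> lk; apply/negP => acc; apply: nacc; exists k.
  have [m] := halving_lt (delta l) d1_gt0; apply/negP; rewrite -leNgt.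
  suff <- : delta (l + m)%N = 2^-1 ^+ m * delta l by [].
  elim: m => [|m IHm]; first by rewrite addn0 mul1r.
  rewrite addnS /delta -/st stS.
  rewrite (outer_step_reject _ (g0 _) (rej _ (leq_addr _ _))) /=.
  by rewrite -/(delta _) IHm exprS mulrA.
(* Below this bound the contraction factor is nonnegative. *)
pose dlow := Num.min d1 (rho * alpha_low R * mu)^-1.
have dlow_gt0 : 0 < dlow by rewrite lt_min d1_gt0 invr_gt0 !mulr_gt0.
have dlow_le k : dlow <= delta k by rewrite ge_min delta_ge.
pose c := rho * dlow * alpha_low R * mu.
have c1 : 0 <= 1 - c.
  have -> : c = dlow * (rho * alpha_low R * mu) by rewrite /c; ring.
  by rewrite subr_ge0 -ler_pdivlMr ?mulr_gt0// div1r ge_min lexx orbT.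
right; exists dlow => //; split=> // t taut.
suff [l ellt [ll rate]] : exists2 l, ell t = Some l & (ltau <= l)%N /\
    F (theta l) - Flow <= (1 - c) ^+ (t - tau) * (F (theta ltau) - Flow).
  by exists l => //; split; [exact: Cth|].
rewrite -(subnKC taut) addKn; elim: (t - tau)%N => [|m [l ellm [ll rate]]].
  by rewrite addn0; exists ltau => //; split=> //; rewrite expr0 mul1r.
have [j lj accj] := accept_after l ll.
have decr k : accepts F rho (st k) -> F (theta k.+1) < F (theta k).
  move=> acc; rewrite /theta -/st stS (accept_theta _ (g0 k) acc).
  exact: (accept_decrease rho0 (wf k) (g0 k) acc).
have [k [nextk lk thk thk1]] : exists k, [/\ next_accepted theta l = Some k.+1,
    (l <= k)%N, theta k = theta l & theta k.+1 != theta l].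
  (* If the iterate is still [theta l] at [j], the acceptance there changes it, since [F] strictly
     decreases; otherwise [j] itself is a witness. *)
  apply: next_acceptedP; have [thj|thj] := eqVneq (theta j) (theta l).
    exists j.+1 => //; rewrite -thj; apply/eqP => thj1.
    by have := decr _ accj; rewrite thj1 ltxx.
  exists j => //; rewrite ltn_neqAle lj andbT.
  by apply: contraNneq thj => ->.
(* A rejection at [k] would leave the iterate equal to [theta l]. *)
have acck : accepts F rho (st k).
  apply: contraT => rej; move: thk1.
  rewrite /theta -/st stS (outer_step_reject _ (g0 k) rej) /=.
  by rewrite -/(theta k) thk eqxx.
exists k.+1; first by rewrite addnS /ell /= -/ell ellm.
split; first exact: leq_trans ll (leqW lk).
(* By the induction hypothesis it remains to contract the gap once by [1 - c], starting from
   [theta k]. *)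
rewrite exprS -mulrA; apply: le_trans (ler_wpM2l c1 rate); rewrite -thk.
have Cl : C (theta l) by exact: Cth.
(* Since [F] is bounded below, [inf] is a true lower bound of its values on [C]. *)
have gap0 : 0 <= F (theta k) - Flow.
  rewrite subr_ge0 thk; apply: inf_lbound; last by exists (theta l).
  by exists Flb => _ [x _ <-]; apply: lbF; exists x.
have PLk : mu * (F (theta k) - Flow) <= l2norm (grad F (theta k)) ^+ 2.
  by rewrite thk; exact: PL.
have [_ L0 _] := wf k.
(* The PL inequality, combined with the lower bounds [dlow] and [alpha_low R], shows that the wanted
   reduction is at most the decrease enforced by acceptance. *)
have : c * (F (theta k) - Flow) <= rho * delta k * inner_step F (st k) 0 *
    l2norm (grad F (theta k)) ^+ 2.
  have mugap0 : 0 <= mu * (F (theta k) - Flow) by rewrite mulr_ge0// ltW.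
  rewrite /c -!mulrA ler_pM2l//.
  apply: ler_pM (ltW dlow_gt0) _ (dlow_le k) _; first by rewrite mulr_ge0// ltW.
  exact: ler_pM (ltW al0) mugap0 (inner_step_ge _ _ L0) PLk.
move: (acck); rewrite /accepts -(accept_theta dbar (g0 k) acck).
by rewrite -stS -/(theta k) -/(theta k.+1) -/(delta k); lra.
Qed.
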